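(* Let $w$ and $v$ be words of $X^*$. The monoid $\mathcal{J}_5$ satisfies the identity $w=v$ if and only if $c(w)=c(v)$ and for every non-empty subset $Y$ of $c(w)$ the following conditions (1)–(4) hold: (1) the first letters of $w_Y$ and $v_Y$ are equal; (2) the last letters of $w_Y$ and $v_Y$ are equal; (3) each word of length $2$ occurs in $w_Y$ if and only if it occurs in $v_Y$; (4) for all $x,y,z,t\in Y$ with $xy\neq zt$ (as words) and all words $w_1,w_2,v_1,v_2\in Y^*$ such that $w_Y=w_1xyw_2$ and $v_Y=v_1ztv_2$, putting $C_1=\{w_1x,\,v_1z\}$ and $C_2=\{yw_2,\,tv_2\}$, the following hold: (a) if neither $xy$ nor $zt$ occurs in any element of $C_1$, then $x\neq z$; (b) if $y$ does not occur in any element of $C_1$, then $y\neq t$; (c) if neither $xy$ nor $zt$ occurs in any element of $C_2$, then $y\neq t$; (d) if $x$ does not occur in any element of $C_2$, then $x\neq z$; (e) for each $C\in\{C_1,C_2\}$: if $x\neq z$, $y\neq t$ and neither $xy$ nor $zt$ occurs in any element of $C$, then (i) $xt$ occurs in at least one element of $C$; (ii) $zy$ occurs in at least one element of $C$; (iii) there do not exist a subset $Y'$ with $\{x,y,z,t\}\subseteq Y'\subseteq Y$ and subsets $Y_1,Y_2$ with $Y'=Y_1\cup Y_2$ such that: (A) $Y_1\cap Y_2=\emptyset$; (B) if $u\in Y_1$, then $xu$ does not occur in $o_{Y'}$ for every $o\in C$; (C) if $u'\in Y_2$, then $zu'$ does not occur in $o_{Y'}$ for every $o\in C$; (D) neither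 $xy$ nor $zt$ occurs in $o_{Y'}$ for every $o\in C$; (iv) there do not exist a subset $Y'$ with $\{x,y,z,t\}\subseteq Y'\subseteq Y$ and subsets $Y_1,Y_2$ with $Y'=Y_1\cup Y_2$ such that: (A) $Y_1\cap Y_2=\emptyset$; (B) if $u\in Y_1$, then $uy$ does not occur in $o_{Y'}$ for every $o\in C$; (C) if $u'\in Y_2$, then $u't$ does not occur in $o_{Y'}$ for every $o\in C$; (D) neither $xy$ nor $zt$ occurs in $o_{Y'}$ for every $o\in C$.
   Context: $X$ is a countably infinite set (alphabet) of letters; $X^*$ is the free monoid over $X$, with empty word $1$; $X^+=X^*\setminus\{1\}$. For a word $t$, $c(t)$ (the content) is the set of letters appearing in $t$ (so $c(1)=\emptyset$). A word $s\in X^+$ (in particular a letter) occurs in $t$ if $t=t_1st_2$ for some $t_1,t_2\in X^*$, i.e. $s$ is a contiguous factor of $t$. A subword of $t$ is a (scattered) subsequence of $t$; for $Y\subseteq X$, $t_Y$ is the longest subword of $t$ with content contained in $Y$, i.e. the word obtained from $t$ by deleting all letters not in $Y$. A monoid $M$ satisfies the identity $w=v$ (with $w,v\in X^*$) if $\phi(w)=\phi(v)$ for every monoid homomorphism $\phi\colon X^*\to M$. The Jones monoid $\mathcal{J}_5$ is the monoid generated by $h_1,h_2,h_3,h_4$ subject to the relations $h_ih_j=h_jh_i$ if $|i-j|\ge 2$, $h_ih_jh_i=h_i$ if $|i-j|=1$, and $h_i^2=h_i$, for all $i,j\in\{1,2,3,4\}$. *)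

(* Defs.v *)
From HB Require Import structures.
From mathcomp Require Import all_boot all_order all_algebra.
From mathcomp Require Import generic_quotient finmap.
From mathcomp Require Import boolp classical_sets cardinality.

Set Implicit Arguments.
Unset Strict Implicit.
Unset Printing Implicit Defensive.

(* The free monoid X^* on X: words, under concatenation. *)
Definition word (X : Type) : Type := seq X.

Section FreeMonoid.
Variable X : choiceType.

HB.instance Definition _ := Choice.copy (word X) (seq X).

HB.instance Definition _ :=
  isMonoid.Build (word X) (@catA X) (@cat0s X) (@cats0 X).

End FreeMonoid.

(* The monoid generated by G subject to the relations u = v for R u v: the
   quotient of the free monoid by the least congruence containing R. *)
Section Presentation.
Variables (G : choiceType) (R : word G -> word G -> Prop).

Inductive congruence : word G -> word G -> Prop :=
| congr_rel u v : R u v -> congruence u v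
| congr_refl u : congruence u u
| congr_sym u v : congruence u v -> congruence v u
| congr_trans u v s : congruence u v -> congruence v s -> congruence u s
| congr_mul u u' v v' :
    congruence u u' -> congruence v v' -> congruence (u ++ v) (u' ++ v').

Definition congruenceb : rel (word G) := fun u v => `[< congruence u v >].

Lemma congruenceb_refl : reflexive congruenceb.
Proof. by move=> u; apply/asboolP; exact: congr_refl. Qed.

Lemma congruenceb_sym : symmetric congruenceb.
Proof. by move=> u v; apply/asboolP/asboolP; exact: congr_sym. Qed.

Lemma congruenceb_trans : transitive congruenceb.
Proof.
by move=> u v s /asboolP uv /asboolP vs; apply/asboolP; exact: congr_trans vs.
Qed.

Canonical congruence_equiv :=
  EquivRel congruenceb congruenceb_refl congruenceb_sym congruenceb_trans.

Definition presented : Type := {eq_quot congruenceb}%qT.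

HB.instance Definition _ := Choice.on presented.
HB.instance Definition _ := EqQuotient.on presented.

Definition presented_class (u : word G) : presented := \pi_presented%qT u.

Lemma presented_classP u v :
  presented_class u = presented_class v <-> congruence u v.
Proof.
split=> [/eqquotP /asboolP //|uv]; apply/eqquotP; exact/asboolP.
Qed.

Lemma presented_classK a : presented_class (repr a) = a.
Proof. exact: reprK. Qed.

Definition presented_one : presented := presented_class [::].

Definition presented_mul (a b : presented) : presented :=
  presented_class (repr a ++ repr b).

Lemma presented_mulE u v :
  presented_mul (presented_class u) (presented_class v)
  = presented_class (u ++ v).
Proof.
apply/presented_classP.
by apply: congr_mul; apply/presented_classP; rewrite presented_classK.
Qed.

Lemma presented_mulA : associative presented_mul.
Proof.
move=> a b c.
rewrite -[a]presented_classK -[b]presented_classK -[c]presented_classK.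
by rewrite !presented_mulE catA.
Qed.

Lemma presented_mul1g : left_id presented_one presented_mul.
Proof. by move=> a; rewrite -[a]presented_classK presented_mulE. Qed.

Lemma presented_mulg1 : right_id presented_one presented_mul.
Proof. by move=> a; rewrite -[a]presented_classK presented_mulE cats0. Qed.

HB.instance Definition _ :=
  isMonoid.Build presented presented_mulA presented_mul1g presented_mulg1.

End Presentation.

(* Relations of the Jones monoid J_n; the generators h_1, ..., h_(n-1) are
   indexed from 0, i.e. (i : 'I_n.-1) stands for h_(i+1). *)
Inductive jones_rel (n : nat) : word 'I_n.-1 -> word 'I_n.-1 -> Prop :=
| jones_comm (i j : 'I_n.-1) :
    (2 <= `|i - j|)%N -> jones_rel [:: i; j] [:: j; i]
| jones_braid (i j : 'I_n.-1) :
    `|i - j|%N = 1%N -> jones_rel [:: i; j; i] [:: i]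
| jones_idem (i : 'I_n.-1) : jones_rel [:: i; i] [:: i].

Definition jones (n : nat) : monoidType := presented (@jones_rel n).

Definition satisfies (X : choiceType) (M : monoidType) (w v : word X) : Prop :=
  forall phi : word X -> M, monoid_morphism phi -> phi w = phi v.

Section Words.
Variable X : choiceType.
Implicit Types (w v o s : word X) (Y : {fset X}) (C : {fset word X}).

Local Open Scope fset_scope.

Definition content w : {fset X} := [fset x in w].

(* The subword w_Y. *)
Definition restrict w Y : word X := [seq x <- w | x \in Y].

Definition first_letter w : option X := ohead w.
Definition last_letter w : option X := ohead (rev w).

Definition occurs s w : bool := infix s w.

Definition occurs_in_some s C : Prop := exists2 o, o \in C & occurs s o.

Definition occurs_in_none s C : Prop := forall o, o \in C -> ~~ occurs s o.

(* The configurations forbidden by (iii) and (iv): "for every o in C" is the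
   outer quantifier of each non-occurrence clause, so that each of the factors
   mentioned is absent from all the words o_{Y'}, o in C. The sets Y1 and Y2
   may be empty. *)
Definition left_splitting Y C (x y z t : X) : Prop :=
  exists Y' Y1 Y2 : {fset X},
    [fset x; y; z; t] `<=` Y' /\ Y' `<=` Y /\ Y' = Y1 `|` Y2 /\
    Y1 `&` Y2 = fset0 /\
    (forall u, u \in Y1 ->
       forall o, o \in C -> ~~ occurs [:: x; u] (restrict o Y')) /\
    (forall u', u' \in Y2 ->
       forall o, o \in C -> ~~ occurs [:: z; u'] (restrict o Y')) /\
    (forall o, o \in C ->
       ~~ occurs [:: x; y] (restrict o Y') /\
       ~~ occurs [:: z; t] (restrict o Y')).

Definition right_splitting Y C (x y z t : X) : Prop :=
  exists Y' Y1 Y2 : {fset X},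
    [fset x; y; z; t] `<=` Y' /\ Y' `<=` Y /\ Y' = Y1 `|` Y2 /\
    Y1 `&` Y2 = fset0 /\
    (forall u, u \in Y1 ->
       forall o, o \in C -> ~~ occurs [:: u; y] (restrict o Y')) /\
    (forall u', u' \in Y2 ->
       forall o, o \in C -> ~~ occurs [:: u'; t] (restrict o Y')) /\
    (forall o, o \in C ->
       ~~ occurs [:: x; y] (restrict o Y') /\
       ~~ occurs [:: z; t] (restrict o Y')).

End Words.

(* Main.v *)
Require Import Defs.
From mathcomp Require Import all_boot all_order all_algebra.
From mathcomp Require Import finmap.
From mathcomp Require Import boolp classical_sets cardinality.

Set Implicit Arguments.
Unset Strict Implicit.
Unset Printing Implicit Defensive.

(** The 42 elements of J_5 are the planar diagrams on two rows of five points: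
    the identity, the 16 diagrams with one cup on the top row and one on the
    bottom row, and the 25 diagrams with two cups on each row, which form a
    rectangular band and the minimal ideal.  A diagram is determined by its top
    half and its bottom half, turning a diagram upside down reverses products,
    and the top half of a product mn depends on n only through its top half
    ([top_mul]).  Hence J_5 satisfies w = v if and only if, for every
    assignment of diagrams to letters, the products along w and v have the same
    top half, and likewise for the reversed words ([satisfies_left_equiv]).

    The top half of a product is read off from the left.  Letters sent to the
    identity are erased, which passes from w to some w_Y.  If the first
    remaining letter has two cups, it fixes the top half.  Otherwise it has one
    cup, and the top half is this cup until the product first falls into the
    minimal ideal.  This happens at the first factor xy of w_Y for which the
    bottom cup of x and the top half of y do not fit together ([bend]), and
    this factor only decides whether the new cup joins the first two or the
    last two of the three points left free by the first cup ([upper_bend]).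
    So two words with the same first letters and the same factors of length
    two differ, under a suitable assignment, exactly when the first bending
    factor xy of w_Y and the first bending factor zt of v_Y pull to opposite
    sides.

    What remains is to see which opposite pairs are possible when no bending
    factor occurs in the prefixes w1x and v1z.  For letters with one cup, where
    rows are the bottom cup j of the left letter and columns the top cup k of
    the right letter, the bends recorded by [turn] are

        left:  (1,3) (3,1) (4,1)        right:  (1,4) (2,4) (4,2).

    A column never contains both sides; a row does only when j is 1 or 4.  If
    the rows and the columns of xy and zt are distinct and neither xt nor zy
    bends, then the two rows are 1 and 4 or the two columns are 1 and 4
    ([opposite_turns]), and any letter bends after x or after z, respectively
    before y or before t.  Recording which letters do so yields precisely one of
    the excluded splittings ([compatible_bends]).  Conversely, a
    violation of any of the conditions is turned into an assignment for which
    the only bending pairs are absent from the two prefixes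
    ([left_conditions_of_equiv]). *)

(** * Planar diagrams on five points *)

(** The generator h_i; also the position of a single cup, which then joins the
    points i and i+1. *)
Inductive hook := h1 | h2 | h3 | h4.

(** The noncrossing ways to join four of the five points in pairs without
    covering the free one. *)
Inductive cups := c12_34 | c12_45 | c23_45 | c14_23 | c25_34.

Inductive half := Whole | Cup of hook | Cups of cups.

Inductive side := Lft | Rgt.

(** Glue the top half [t] below a row whose only cup is at [j].  Three strands
    arrive from the remaining points of that row; the result says whether they
    all pass through, or whether [t] joins the first two or the last two of
    them. *)
Definition turn (j : hook) (t : half) : option side :=
  match t, j with
  | Whole, _ => None
  | Cup h1, (h3 | h4) | Cup h3, h1 => Some Lft
  | Cup h2, h4 | Cup h4, (h1 | h2) => Some Rgt
  | Cup _, _ => None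
  | Cups c12_34, _ | Cups c12_45, (h3 | h4) => Some Lft
  | Cups c14_23, (h1 | h2 | h3) | Cups c25_34, h1 => Some Lft
  | Cups _, _ => Some Rgt
  end.

(** The cup at [i] together with a cup joining the first two or the last two
    of the three points that it leaves free. *)
Definition extra (i : hook) (e : side) : cups :=
  match i, e with
  | (h1 | h3), Lft => c12_34
  | h1, Rgt | h4, Lft => c12_45
  | (h2 | h4), Rgt => c23_45
  | h2, Lft => c14_23
  | h3, Rgt => c25_34
  end.

Definition attach (i : hook) (o : option side) : half :=
  if o is Some e then Cups (extra i e) else Cup i.

(** Given its two halves, a diagram has no further freedom: the free points are
    joined from top to bottom in increasing order. *)
Inductive diagram := Id | Hook (i j : hook) | Flat (a b : cups).

Definition top (m : diagram) : half :=
  match m with Id => Whole | Hook i _ => Cup i | Flat a _ => Cups a end.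

Definition flip (m : diagram) : diagram :=
  match m with Id => Id | Hook i j => Hook j i | Flat a b => Flat b a end.

Definition act (m : diagram) (t : half) : half :=
  match m with
  | Id => t
  | Hook i j => attach i (turn j t)
  | Flat a _ => Cups a
  end.

(** In [mul] both halves have the same number of cups; for other pairs of
    halves, [Id] is a default value. *)
Definition pack (t b : half) : diagram :=
  match t, b with
  | Cup i, Cup j => Hook i j
  | Cups a, Cups b => Flat a b
  | _, _ => Id
  end.

Definition mul (m n : diagram) : diagram :=
  pack (act m (top n)) (act (flip n) (top (flip m))).

Lemma flipK : involutive flip. Proof. by case. Qed.

Lemma diagram_eq m n : top m = top n -> top (flip m) = top (flip n) -> m = n.
Proof. by case: m n => [|i j|a b] [|k l|c d] //= [->] [->]. Qed.

Lemma mul_halves m n : top (mul m n) = act m (top n) /\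
  top (flip (mul m n)) = act (flip n) (top (flip m)).
Proof.
case: m n => [|i j|a b] [|k l|c d] //; rewrite /mul /=.
- by case: j k => [] [].
- by case: j c => [] [].
- by case: k b => [] [].
Qed.

Lemma top_mul m n : top (mul m n) = act m (top n).
Proof. exact: (mul_halves m n).1. Qed.

Lemma flip_mul m n : flip (mul m n) = mul (flip n) (flip m).
Proof.
by apply: diagram_eq; rewrite ?flipK top_mul ?flipK (mul_halves _ _).2 ?flipK.
Qed.

Lemma act_mul m n t : act (mul m n) t = act m (act n t).
Proof.
case: m n => [|i j|a b] [|k l|c d] //; rewrite /mul /=.
- by case: j k l t => [] [] [] [|[]|[]].
- by case: j c => [] [].
- by case: k b => [] [].
Qed.

Lemma mulA : associative mul.
Proof.
move=> m n p; apply: diagram_eq; first by rewrite !(top_mul, act_mul).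
by rewrite !flip_mul !(top_mul, act_mul).
Qed.

Lemma mul1d : left_id Id mul. Proof. by case. Qed.
Lemma muld1 : right_id Id mul. Proof. by case. Qed.

Definition prodd (s : seq diagram) : diagram := foldr mul Id s.

Lemma prodd_cat s t : prodd (s ++ t) = mul (prodd s) (prodd t).
Proof. by elim: s => [|m s IHs] /=; rewrite ?mul1d // IHs mulA. Qed.

Lemma flip_prodd (s : seq diagram) :
  flip (prodd s) = prodd [seq flip m | m <- rev s].
Proof.
elim: s => //= m s IHs; rewrite flip_mul IHs rev_cons map_rcons -cats1.
by rewrite prodd_cat /= muld1.
Qed.

(** * The Jones monoid is the monoid of diagrams *)

Definition gen (i : 'I_4) : hook :=
  match val i with 0 => h1 | 1 => h2 | 2 => h3 | _ => h4 end.

Definition index_of (h : hook) : 'I_4 :=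
  match h with
  | h1 => @Ordinal 4 0 isT | h2 => @Ordinal 4 1 isT
  | h3 => @Ordinal 4 2 isT | h4 => @Ordinal 4 3 isT
  end.

Lemma genK : cancel gen index_of.
Proof. by case=> [[|[|[|[|]]]]] // ?; apply/val_inj. Qed.

Definition eval (u : word 'I_4) : diagram :=
  prodd [seq Hook (gen i) (gen i) | i <- u].

Lemma eval_cat u v : eval (u ++ v) = mul (eval u) (eval v).
Proof. by rewrite /eval map_cat prodd_cat. Qed.

Lemma eval_congruence u v : congruence (@jones_rel 5) u v -> eval u = eval v.
Proof.
elim=> {u v} // [u v [i j|i j|i]|u v s _ -> _ ->|u u' v v' _ eu _ ev] //.
- by rewrite -[i]genK -[j]genK; case: (gen i) => []; case: (gen j).
- by rewrite -[i]genK -[j]genK; case: (gen i) => []; case: (gen j).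
- by rewrite /eval /=; case: (gen i).
by rewrite !eval_cat eu ev.
Qed.

Section NormalForms.
Local Open Scope group_scope.

Definition hk (h : hook) : jones 5 :=
  presented_class (@jones_rel 5) [:: index_of h].

Lemma presented_classM u v :
  presented_class (@jones_rel 5) (u ++ v)
  = (presented_class (@jones_rel 5) u : jones 5)
      * presented_class (@jones_rel 5) v.
Proof. by rewrite -presented_mulE. Qed.

Lemma hk_word (s : seq hook) a :
  foldr (fun h b => hk h * b) a s
  = presented_class (@jones_rel 5) [seq index_of h | h <- s] * a.
Proof.
elim: s => [|h s /= ->]; first by rewrite /= mul1g.
by rewrite mulgA /hk -presented_classM.
Qed.

(** All equations of this section are between products associated to the right
    and carry a free tail [a], so that they rewrite anywhere in a product. *)
Lemma hk_rel (s t : seq hook) a :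
  jones_rel (n := 5) [seq index_of h | h <- s] [seq index_of h | h <- t] ->
  foldr (fun h b => hk h * b) a s = foldr (fun h b => hk h * b) a t.
Proof.
by move=> st; rewrite !hk_word; congr (_ * a); apply/presented_classP/congr_rel.
Qed.

Definition far (i j : hook) : bool :=
  match i, j with
  | h1, (h3 | h4) | h2, h4 | h3, h1 | h4, (h1 | h2) => true
  | _, _ => false
  end.

Definition adjacent (i j : hook) : bool :=
  match i, j with
  | h1, h2 | h2, (h1 | h3) | h3, (h2 | h4) | h4, h3 => true
  | _, _ => false
  end.

Lemma hk_comm i j a : far i j -> hk i * (hk j * a) = hk j * (hk i * a).
Proof.
move=> far_ij; apply: (@hk_rel [:: i; j] [:: j; i]); apply: jones_comm.
by case: i j far_ij => [] [].
Qed.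

Lemma hk_braid i j a :
  adjacent i j -> hk i * (hk j * (hk i * a)) = hk i * a.
Proof.
move=> adj_ij; apply: (@hk_rel [:: i; j; i] [:: i]); apply: jones_braid.
by case: i j adj_ij => [] [].
Qed.

Lemma hk_idem i a : hk i * (hk i * a) = hk i * a.
Proof. exact/(@hk_rel [:: i; i] [:: i])/jones_idem. Qed.

Lemma hk_3213 a :
  hk h3 * (hk h2 * (hk h1 * (hk h3 * a))) = hk h1 * (hk h3 * a).
Proof. by rewrite (@hk_comm h1 h3) // hk_braid // (@hk_comm h3 h1). Qed.

Lemma hk_4324 a :
  hk h4 * (hk h3 * (hk h2 * (hk h4 * a))) = hk h2 * (hk h4 * a).
Proof. by rewrite (@hk_comm h2 h4) // hk_braid // (@hk_comm h4 h2). Qed.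

Lemma hk_43214 a :
  hk h4 * (hk h3 * (hk h2 * (hk h1 * (hk h4 * a))))
  = hk h2 * (hk h1 * (hk h4 * a)).
Proof. by rewrite (@hk_comm h1 h4) // hk_4324 // (@hk_comm h1 h4). Qed.

Lemma hk_1321 a :
  hk h1 * (hk h3 * (hk h2 * (hk h1 * a))) = hk h1 * (hk h3 * a).
Proof. by rewrite (@hk_comm h1 h3) // hk_braid // (@hk_comm h3 h1). Qed.

Lemma hk_2432 a :
  hk h2 * (hk h4 * (hk h3 * (hk h2 * a))) = hk h2 * (hk h4 * a).
Proof. by rewrite (@hk_comm h2 h4) // hk_braid // (@hk_comm h4 h2). Qed.

Lemma hk_14321 a :
  hk h1 * (hk h4 * (hk h3 * (hk h2 * (hk h1 * a))))
  = hk h1 * (hk h4 * (hk h3 * a)).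
Proof. by rewrite (@hk_comm h1 h4) // hk_1321 // (@hk_comm h1 h4). Qed.

(** A terminating rewriting system: every rule shortens the word or sorts two
    commuting letters.  The last six rules are consequences of the relations
    which make the critical pairs met in [hk_elt] confluent. *)
Definition hk_normal := (
  fun a => @hk_comm h3 h1 a isT, fun a => @hk_comm h4 h1 a isT,
  fun a => @hk_comm h4 h2 a isT, hk_idem,
  fun a => @hk_braid h1 h2 a isT, fun a => @hk_braid h2 h1 a isT,
  fun a => @hk_braid h2 h3 a isT, fun a => @hk_braid h3 h2 a isT,
  fun a => @hk_braid h3 h4 a isT, fun a => @hk_braid h4 h3 a isT,
  hk_3213, hk_4324, hk_43214, hk_1321, hk_2432, hk_14321).

Definition path_word (i j : hook) : seq hook :=
  match i, j with
  | h1, h1 => [:: h1] | h1, h2 => [:: h1; h2] | h1, h3 => [:: h1; h2; h3]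
  | h1, h4 => [:: h1; h2; h3; h4]
  | h2, h1 => [:: h2; h1] | h2, h2 => [:: h2] | h2, h3 => [:: h2; h3]
  | h2, h4 => [:: h2; h3; h4]
  | h3, h1 => [:: h3; h2; h1] | h3, h2 => [:: h3; h2] | h3, h3 => [:: h3]
  | h3, h4 => [:: h3; h4]
  | h4, h1 => [:: h4; h3; h2; h1] | h4, h2 => [:: h4; h3; h2]
  | h4, h3 => [:: h4; h3] | h4, h4 => [:: h4]
  end.

(** A word whose diagram has [a] as its top half.  Diagrams with two cups
    multiply as in a rectangular band, so followed by a reversed word of this
    kind it keeps only this top half. *)
Definition cups_word (a : cups) : seq hook :=
  match a with
  | c12_34 => [:: h1; h3] | c12_45 => [:: h1; h4] | c23_45 => [:: h2; h4]
  | c14_23 => [:: h2; h1; h3] | c25_34 => [:: h3; h2; h4]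
  end.

Definition diagram_word (m : diagram) : seq hook :=
  match m with
  | Id => [::]
  | Hook i j => path_word i j
  | Flat a b => cups_word a ++ rev (cups_word b)
  end.

Definition elt (m : diagram) : jones 5 :=
  presented_class (@jones_rel 5) [seq index_of h | h <- diagram_word m].

Lemma eltE m : elt m = foldr (fun h a => hk h * a) 1 (diagram_word m).
Proof. by rewrite hk_word mulg1. Qed.

(** The 42 chosen words are closed, up to the relations, under multiplication
    by a generator on the left: each of the 168 instances is decided by
    rewriting. *)
Lemma hk_elt h m : hk h * elt m = elt (mul (Hook h h) m).
Proof.
rewrite !eltE.
case: m => [|i j|a b]; case: h; try (case: i; case: j);
  try (case: a; case: b); rewrite /= ?hk_normal //.
Qed.

Lemma class_eval u : presented_class (@jones_rel 5) u = elt (eval u).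
Proof.
elim: u => // i u IHu; rewrite [RHS]/= -[RHS]hk_elt.
by rewrite -IHu /hk genK -presented_classM.
Qed.

Lemma eval_diagram_word m :
  eval [seq index_of h | h <- diagram_word m] = m.
Proof. by case: m => [|[] []|[] []]. Qed.

Lemma satisfies_diagram (X : choiceType) (w v : word X) :
  satisfies (jones 5) w v <->
  forall phi : X -> diagram,
    prodd [seq phi x | x <- w] = prodd [seq phi x | x <- v].
Proof.
split=> [sat phi | sat Phi [Phi1 PhiM]].
  pose f (s : word X) := flatten
    [seq [seq index_of h | h <- diagram_word (phi x)] | x <- s].
  have eval_f s : eval (f s) = prodd [seq phi x | x <- s].
    by elim: s => //= x s IHs; rewrite eval_cat eval_diagram_word IHs.
  rewrite -!eval_f; apply/eval_congruence/presented_classP.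
  apply: (sat (fun s => presented_class (@jones_rel 5) (f s) : jones 5)).
  split=> // s s'; rewrite -presented_classM.
  by congr (presented_class _ _); rewrite /f map_cat flatten_cat.
pose phi x := eval (repr (Phi [:: x])).
have PhiE s : Phi s = elt (prodd [seq phi x | x <- s]).
  elim: s => [|x s IHs]; first exact: Phi1.
  rewrite -[x :: s]/(([:: x] : word X) * s) PhiM IHs.
  rewrite -{1}[Phi [:: x]]presented_classK /elt -presented_classM.
  by rewrite !class_eval eval_cat !eval_diagram_word.
by rewrite !PhiE sat.
Qed.

End NormalForms.

(** * Top halves of products along a word *)

Arguments turn : simpl never.

(** Once the three strands have been turned, nothing glued further below
    changes this; and if they pass through the cup at [k], it is the next
    cup which decides. *)
Lemma turn_attach j k o :
  turn j (attach k o) = if turn j (Cup k) is Some e then Some e else o.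
Proof. by case: j k o => [] [] [[]|]. Qed.

Lemma extra_inj i : injective (extra i).
Proof. by case: i => [] [] []. Qed.

Section Upper.
Variable X : choiceType.
Implicit Types (w v s : word X) (phi : X -> diagram) (Y : {fset X}).

Definition upper phi w : half := foldr (fun x => act (phi x)) Whole w.

Lemma top_prodd phi w : top (prodd [seq phi x | x <- w]) = upper phi w.
Proof. by elim: w => //= x w <-; rewrite top_mul. Qed.

Definition left_equiv w v := forall phi, upper phi w = upper phi v.

Lemma left_equiv_sym w v : left_equiv w v -> left_equiv v w.
Proof. by move=> wv phi; rewrite wv. Qed.

(** Turning all diagrams upside down is an anti-automorphism, so the bottom
    half of the product along [w] is a top half along [rev w]. *)
Lemma satisfies_left_equiv w v :
  satisfies (jones 5) w v <-> left_equiv w v /\ left_equiv (rev w) (rev v).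
Proof.
rewrite satisfies_diagram.
have flipE phi s : top (flip (prodd [seq phi x | x <- s]))
    = upper (flip \o phi) (rev s).
  by rewrite flip_prodd -map_rev -map_comp top_prodd.
split=> [eqv|[eqv eqr] phi].
  split=> phi; first by rewrite -!top_prodd eqv.
  have phiE : flip \o (flip \o phi) =1 phi by move=> x; rewrite /= flipK.
  have upE s : upper phi s = upper (flip \o (flip \o phi)) s.
    by rewrite -!top_prodd (eq_map phiE).
  by rewrite !upE -!flipE eqv.
by apply: diagram_eq; rewrite ?top_prodd ?flipE.
Qed.

(* In the next two definitions h1 is a default value. *)
Definition entry phi x : hook := if phi x is Hook i _ then i else h1.
Definition exit phi x : hook := if phi x is Hook _ j then j else h1.

Definition is_hook (m : diagram) : bool :=
  if m is Hook _ _ then true else false.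

(** When [x] has one cup on each row: how the product of the letters [x] and
    [y] falls into the minimal ideal, if it does. *)
Definition bend phi x y : option side := turn (exit phi x) (top (phi y)).

(** The product along [s] stays outside the minimal ideal and no letter of
    [s] is erased. *)
Definition straight phi s : bool :=
  all (fun x => is_hook (phi x)) s && sorted (fun x y => ~~ bend phi x y) s.

Lemma straight_hook phi s x : straight phi s -> x \in s -> is_hook (phi x).
Proof. by case/andP=> /allP hs _; apply: hs. Qed.

Lemma straightP phi s :
  straight phi s <-> (forall x, x \in s -> is_hook (phi x)) /\
    (forall x y, occurs [:: x; y] s -> bend phi x y = None).
Proof.
split=> [str|[hks bends]].
  split=> [x|x y]; first exact: straight_hook.
  case/infixP=> s1 [s2 def_s]; case/andP: str => _.
  by rewrite def_s => /cat_sorted2[_] /=; case: (bend phi x y).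
apply/andP; split; first exact/allP.
case: s {hks} bends => // a s; elim: s a => // b s IHs a bends /=.
have -> : bend phi a b = None.
  by apply: bends; rewrite /occurs /= prefix0s !eqxx.
apply: IHs => x y occ; apply: bends.
by rewrite /occurs -[a :: _]cat1s; apply: infix_catl.
Qed.

Lemma upper_straight_cat phi p s w : straight phi (p :: s) ->
  upper phi (p :: s ++ w)
  = attach (entry phi p) (turn (exit phi (last p s)) (upper phi w)).
Proof.
elim: s p => [|q s IHs] p /=.
  by rewrite /straight /entry /exit /=; case: (phi p).
case/andP=> /= /andP[hp hs] /andP[bend_pq path_s].
have /IHs : straight phi (q :: s) by rewrite /straight /= hs path_s.
rewrite /= => -> /=; move: hp bend_pq hs; rewrite /bend /exit /entry.
case: (phi p) => // i j _; case: (phi q) => //= k l.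
by rewrite turn_attach; case: (turn j (Cup k)).
Qed.

Lemma upper_straight phi p s :
  straight phi (p :: s) -> upper phi (p :: s) = Cup (entry phi p).
Proof. by move/(upper_straight_cat [::]); rewrite cats0 => ->. Qed.

(** The first bend and the first letter determine the top half, whatever
    follows. *)
Lemma upper_bend phi w1 x y w2 e :
  straight phi (rcons w1 x) -> bend phi x y = Some e ->
  upper phi (w1 ++ [:: x; y] ++ w2)
  = Cups (extra (entry phi (head x w1)) e).
Proof.
have bendE o : bend phi x y = Some e ->
    turn (exit phi x) (act (phi y) o) = Some e.
  by rewrite /bend; case: (phi y) => //= k l; rewrite turn_attach => ->.
move=> + bxy.
case: w1 => [|p w1] /=.
  by move=> /(upper_straight_cat (y :: w2)) /= ->; rewrite bendE.
move=> /(upper_straight_cat (y :: w2)); rewrite cat_rcons /= => ->.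
by rewrite last_rcons bendE.
Qed.

Lemma straight_or_bend phi u x s :
  straight phi (rcons u x) -> (forall y, y \in s -> phi y <> Id) ->
  straight phi (u ++ x :: s) \/
  exists w1 a b w2 e, [/\ u ++ x :: s = w1 ++ [:: a; b] ++ w2,
    straight phi (rcons w1 a) & bend phi a b = Some e].
Proof.
elim: s u x => [|y s IHs] u x str notId; first by left; rewrite cats1.
case bxy: (bend phi x y) => [e|]; first by right; exists u, x, y, s, e.
have notIds z : z \in s -> phi z <> Id.
  by move=> zs; apply: notId; rewrite inE zs orbT.
rewrite -cat_rcons; apply: IHs notIds.
case/andP: str => hks srt; rewrite /straight all_rcons hks andbT.
apply/andP; split.
  (* A letter with two cups always bends, so y has one cup. *)
  have := notId y (mem_head _ _); move: bxy; rewrite /bend /turn.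
  by case: (phi y) => //= -[]; case: (exit phi x).
case: u srt {hks} => [|a u] /=; first by rewrite bxy.
by rewrite !rcons_path => ->; rewrite last_rcons bxy.
Qed.

Lemma upper_restrict phi w Y :
  (forall x, x \in w -> x \notin Y -> phi x = Id) ->
  upper phi (restrict w Y) = upper phi w.
Proof.
elim: w => //= x w IHw outY.
have {}IHw : upper phi (restrict w Y) = upper phi w.
  by apply: IHw => y wy; apply: outY; rewrite inE wy orbT.
by case: ifP => [_|/negbT/outY ->] /=; rewrite ?mem_head ?IHw.
Qed.

End Upper.

(** * Words, factors and restrictions *)

Section Factors.
Variable X : choiceType.
Implicit Types (w v s o : word X) (Y : {fset X}) (C : {fset word X}).

Lemma occurs_mem s o a : occurs s o -> a \in s -> a \in o.
Proof. by move=> so; apply: mem_infix. Qed.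

Lemma occurs_pair_mem (a b : X) o :
  occurs [:: a; b] o -> a \in o /\ b \in o.
Proof. by move=> occ; rewrite !(occurs_mem occ) // !inE eqxx ?orbT. Qed.

Lemma occurs_none_absurd s C o : occurs_in_none s C -> o \in C -> ~ occurs s o.
Proof. by move=> none oC; apply/negP/none. Qed.

Lemma in_restrict s Y a : (a \in restrict s Y) = (a \in Y) && (a \in s).
Proof. exact: mem_filter. Qed.

Lemma restrict_id s Y : {subset s <= Y} -> restrict s Y = s.
Proof. by move=> sY; apply/all_filterP/allP. Qed.

Lemma restrict_restrict s Y Y' : (Y' `<=` Y)%fset ->
  restrict (restrict s Y) Y' = restrict s Y'.
Proof.
move/fsubsetP=> Y'Y; rewrite /restrict -filter_predI.
by apply: eq_filter => a /=; case: (boolP (a \in Y')) => // /Y'Y ->.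
Qed.

Lemma restrict_cat s s' Y : restrict (s ++ s') Y = restrict s Y ++ restrict s' Y.
Proof. exact: filter_cat. Qed.

Lemma restrict_rev s Y : restrict (rev s) Y = rev (restrict s Y).
Proof. exact: filter_rev. Qed.

Lemma content_rev s : content (rev s) = content s.
Proof. by apply/fsetP => x; rewrite !inE mem_rev. Qed.

Lemma subset_rev s Y : {subset s <= Y} -> {subset rev s <= Y}.
Proof. by move=> sY a; rewrite mem_rev => /sY. Qed.

Lemma subset_factor w1 w2 x y Y : {subset w1 ++ [:: x; y] ++ w2 <= Y} ->
  [/\ x \in Y, y \in Y, {subset w1 <= Y}, {subset w2 <= Y}
    & {subset w1 ++ [:: x] <= Y}].
Proof.
move=> sub; have sub1 : {subset w1 ++ [:: x] <= Y}.
  move=> a ha; apply: sub.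
  by rewrite -[[:: x; y] ++ w2]/([:: x] ++ y :: w2) catA mem_cat ha.
split=> //.
- by apply: sub1; rewrite mem_cat inE eqxx orbT.
- by apply: sub; rewrite mem_cat !inE eqxx !orbT.
- by move=> a ha; apply: sub1; rewrite mem_cat ha.
- by move=> a ha; apply: sub; rewrite mem_cat !inE ha !orbT.
Qed.

Lemma subset_restrict_factor w w1 w2 x y Y :
  restrict w Y = w1 ++ [:: x; y] ++ w2 ->
  [/\ x \in Y, y \in Y, {subset w1 <= Y}, {subset w2 <= Y}
    & {subset w1 ++ [:: x] <= Y}].
Proof.
by move=> def_w; apply: subset_factor; rewrite -def_w => a;
  rewrite in_restrict => /andP[].
Qed.

Lemma fset_split Y (P : pred X) :
  Y = ([fset u in Y | P u] `|` [fset u in Y | ~~ P u])%fset /\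
  ([fset u in Y | P u] `&` [fset u in Y | ~~ P u] = fset0)%fset.
Proof.
by split; apply/fsetP => u; rewrite !inE; case: (u \in Y); case: (P u).
Qed.

(** The words of [C] are unchanged by restriction to [Y], so [Y] itself serves
    as [Y']; [Y1] gathers the letters admitted on the first side, and the
    others must be admitted on the second one. *)
Lemma left_splitting_cover Y C x y z t :
  (forall o, o \in C -> {subset o <= Y}) -> ([fset x; y; z; t] `<=` Y)%fset ->
  occurs_in_none [:: x; y] C -> occurs_in_none [:: z; t] C ->
  (forall u, occurs_in_none [:: x; u] C \/ occurs_in_none [:: z; u] C) ->
  left_splitting Y C x y z t.
Proof.
move=> subC xyztY nxy nzt cover.
have idC o : o \in C -> restrict o Y = o by move=> /subC/restrict_id.
pose P u := `[< occurs_in_none [:: x; u] C >].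
have [unionY interY] := fset_split Y P.
exists Y, [fset u in Y | P u]%fset, [fset u in Y | ~~ P u]%fset.
split=> //; split=> //; split; first exact: unionY.
split; first exact: interY.
split=> [u|].
  by rewrite !inE => /andP[_ /asboolP nu] o oC; rewrite idC ?nu.
split=> [u|o oC]; last by rewrite idC // nxy ?nzt.
rewrite !inE => /andP[_ /asboolPn nu] o oC; rewrite idC //.
by case: (cover u) => [|->].
Qed.

Lemma right_splitting_cover Y C x y z t :
  (forall o, o \in C -> {subset o <= Y}) -> ([fset x; y; z; t] `<=` Y)%fset ->
  occurs_in_none [:: x; y] C -> occurs_in_none [:: z; t] C ->
  (forall u, occurs_in_none [:: u; y] C \/ occurs_in_none [:: u; t] C) ->
  right_splitting Y C x y z t.
Proof.
move=> subC xyztY nxy nzt cover.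
have idC o : o \in C -> restrict o Y = o by move=> /subC/restrict_id.
pose P u := `[< occurs_in_none [:: u; y] C >].
have [unionY interY] := fset_split Y P.
exists Y, [fset u in Y | P u]%fset, [fset u in Y | ~~ P u]%fset.
split=> //; split=> //; split; first exact: unionY.
split; first exact: interY.
split=> [u|].
  by rewrite !inE => /andP[_ /asboolP nu] o oC; rewrite idC ?nu.
split=> [u|o oC]; last by rewrite idC // nxy ?nzt.
rewrite !inE => /andP[_ /asboolPn nu] o oC; rewrite idC //.
by case: (cover u) => [|->].
Qed.

End Factors.

(** * The conditions that govern top halves *)

Section LeftConditions.
Variable X : choiceType.
Implicit Types (w v s : word X) (phi : X -> diagram) (Y : {fset X}).

(** The requirement on two factors xy and zt that share neither their first nor
    their second letter; it is the same for prefixes and for suffixes. *)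
Definition interlocked Y (C : {fset word X}) (x y z t : X) : Prop :=
  x <> z -> y <> t ->
  occurs_in_none [:: x; y] C -> occurs_in_none [:: z; t] C ->
  occurs_in_some [:: x; t] C /\ occurs_in_some [:: z; y] C /\
  ~ left_splitting Y C x y z t /\ ~ right_splitting Y C x y z t.

(** The requirements on the prefixes; those on the suffixes are the same for
    the reversed words. *)
Definition compatible Y (C : {fset word X}) (x y z t : X) : Prop :=
  (occurs_in_none [:: x; y] C -> occurs_in_none [:: z; t] C -> x <> z) /\
  (occurs_in_none [:: y] C -> y <> t) /\
  interlocked Y C x y z t.

Definition left_conditions w v : Prop :=
  content w = content v /\
  forall Y, Y <> fset0 -> (Y `<=` content w)%fset ->
    first_letter (restrict w Y) = first_letter (restrict v Y) /\
    (forall s, size s = 2 ->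
       (occurs s (restrict w Y) <-> occurs s (restrict v Y))) /\
    (forall x y z t w1 w2 v1 v2,
       x \in Y -> y \in Y -> z \in Y -> t \in Y ->
       [:: x; y] <> [:: z; t] ->
       {subset w1 <= Y} -> {subset w2 <= Y} ->
       {subset v1 <= Y} -> {subset v2 <= Y} ->
       restrict w Y = w1 ++ [:: x; y] ++ w2 ->
       restrict v Y = v1 ++ [:: z; t] ++ v2 ->
       compatible Y [fset w1 ++ [:: x]; v1 ++ [:: z]]%fset x y z t).

End LeftConditions.

(** * The conditions suffice *)

Lemma turn_Cup_side a b c e e' :
  turn a (Cup c) = Some e -> turn b (Cup c) = Some e' -> e = e'.
Proof. by case: a b c e e' => [] [] [] [] []. Qed.

(** If two bends pull to opposite sides while the crossed pairs do not bend,
    the two rows, or the two columns, are 1 and 4: the bottom cup at 1 lets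
    pass only 1 and 2, the one at 4 only 3 and 4, and likewise for top cups. *)
Lemma opposite_turns a b c d e e' :
  turn a (Cup c) = Some e -> turn b (Cup d) = Some e' -> e <> e' ->
  turn a (Cup d) = None -> turn b (Cup c) = None ->
  (forall k, turn a (Cup k) || turn b (Cup k)) \/
  (forall j, turn j (Cup c) || turn j (Cup d)).
Proof.
case: a b c d e e' => [] [] [] [] [] [] // _ _ _ _ _;
  try (by left=> -[]); by right=> -[].
Qed.

Section Sufficiency.
Variable X : choiceType.
Implicit Types (w v s : word X) (phi : X -> diagram) (Y : {fset X}).

(** Opposite sides are impossible: [y] and [t] have one cup because the crossed
    factors xt and zy place them in straight words, and then the complementary
    rows or columns of [opposite_turns] provide a splitting.  A letter with two
    cups occurs in no straight word, so it may be put on either side. *)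
Lemma compatible_bends phi Y (C : {fset word X}) x y z t e e' :
  (forall o, o \in C -> straight phi o) ->
  (forall o, o \in C -> {subset o <= Y}) ->
  ([fset x; y; z; t] `<=` Y)%fset ->
  bend phi x y = Some e -> bend phi z t = Some e' ->
  compatible Y C x y z t -> e = e'.
Proof.
move=> strC subC xyztY bxy bzt [nxz [nyt il]].
have bendC a b : bend phi a b -> occurs_in_none [:: a; b] C.
  move=> bab o oC; apply/negP => occ.
  by move: bab; rewrite ((straightP _ _).1 (strC _ oC)).2.
have hookC o a : o \in C -> a \in o -> is_hook (phi a).
  by move=> oC; apply: straight_hook (strC _ oC).
have oxy : occurs_in_none [:: x; y] C by apply: bendC; rewrite bxy.
have ozt : occurs_in_none [:: z; t] C by apply: bendC; rewrite bzt.
case: (eqVneq x z) => [/nxz []|/eqP xz] //.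
case: (eqVneq y t) => [yt|/eqP yt].
  case: (boolP (is_hook (phi y))) => [|not_hook].
    move: bxy bzt; rewrite -yt /bend; case: (phi y) => // k l bx bz _.
    exact: turn_Cup_side bx bz.
  exfalso; apply: (nyt _ yt) => o oC; apply: contra not_hook => occ.
  by apply: (hookC o) => //; apply: (occurs_mem occ); rewrite mem_head.
have {il} [[o1 o1C oxt] [[o2 o2C ozy] [nl nr]]] := il xz yt oxy ozt.
have bxt : bend phi x t = None by apply: ((straightP _ _).1 (strC _ o1C)).2.
have bzy : bend phi z y = None by apply: ((straightP _ _).1 (strC _ o2C)).2.
have hook_t : is_hook (phi t) := hookC _ _ o1C (occurs_pair_mem oxt).2.
have hook_y : is_hook (phi y) := hookC _ _ o2C (occurs_pair_mem ozy).2.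
apply: contrapT => ee'.
have [comp|comp] :
    (forall u, is_hook (phi u) -> bend phi x u || bend phi z u) \/
    (forall u, is_hook (phi u) -> bend phi u y || bend phi u t).
- move: bxt bzy hook_t hook_y bxy bzt; rewrite /bend.
  case: (phi t) (phi y) => // d d' [] // c c' bxt bzy _ _ bxy bzt.
  case: (opposite_turns bxy bzt ee' bxt bzy) => comp; [left|right] => u.
    by case: (phi u) => // k k' _; apply: comp.
  by move=> _; apply: comp.
- apply/nl/left_splitting_cover => // u.
  case: (boolP (is_hook (phi u))) => [/comp/orP[] bu|not_hook].
  + by left; apply: bendC.
  + by right; apply: bendC.
  left=> o oC; apply: contra not_hook => /occurs_pair_mem[_].
  exact: hookC.
- apply/nr/right_splitting_cover => // u.
  case: (boolP (is_hook (phi u))) => [/comp/orP[] bu|not_hook].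
  + by left; apply: bendC.
  + by right; apply: bendC.
  left=> o oC; apply: contra not_hook => /occurs_pair_mem[+ _].
  exact: hookC.
Qed.

Lemma upper_eq_of_left_conditions phi Y w v :
  (forall a, a \in Y -> phi a <> Id) -> Y <> fset0 ->
  (Y `<=` content w)%fset -> left_conditions w v ->
  upper phi (restrict w Y) = upper phi (restrict v Y).
Proof.
move=> nonId Yn0 Yw [_ /(_ Y Yn0 Yw) [eq_first [eq_pairs comp]]].
have sub0 s a : a \in restrict s Y -> a \in Y by rewrite in_restrict => /andP[].
move: (restrict w Y) (restrict v Y) (sub0 w) (sub0 v) eq_first eq_pairs comp.
move=> [|p s] [|q r] // subw subv [eq_pq]; subst q; move=> eq_pairs comp.
case hp: (phi p) => [|i j|a b]; last by rewrite /= hp.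
  by case: (nonId p); rewrite // subw ?mem_head.
have hook_p : straight phi (rcons [::] p) by rewrite /straight /= hp.
have nonIds u y : (forall a, a \in p :: u -> a \in Y) -> y \in u -> phi y <> Id.
  by move=> sub_u uy; apply/nonId/sub_u; rewrite inE uy orbT.
have [strw|[w1 [x [y [w2 [e [def_w strw bw]]]]]]] :=
  straight_or_bend hook_p (nonIds s ^~ subw);
have [strv|[v1 [z [t [v2 [e' [def_v strv bv]]]]]]] :=
  straight_or_bend hook_p (nonIds r ^~ subv).
- by rewrite !upper_straight.
- suff : bend phi z t = None by rewrite bv.
  have /straightP[_] := strw; apply; apply/eq_pairs => //.
  by rewrite [p :: r]def_v /occurs infix_infix.
- suff : bend phi x y = None by rewrite bw.
  have /straightP[_] := strv; apply; apply/eq_pairs => //.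
  by rewrite [p :: s]def_w /occurs infix_infix.
rewrite /= in def_w def_v; rewrite def_w def_v.
rewrite (upper_bend _ strw bw) (upper_bend _ strv bv).
have <- : e = e'.
  case: (eqVneq [:: x; y] [:: z; t]) => [[xz yt]|/eqP xyzt].
    by move: bv; rewrite -xz -yt bw => -[].
  rewrite def_w in subw comp; rewrite def_v in subv comp.
  have [xY yY w1Y w2Y w1xY] := subset_factor subw.
  have [zY tY v1Y v2Y v1zY] := subset_factor subv.
  have {}comp : compatible Y [fset w1 ++ [:: x]; v1 ++ [:: z]]%fset x y z t.
    exact: (comp x y z t w1 w2 v1 v2).
  apply: compatible_bends bw bv comp.
  - by move=> o; rewrite !inE !cats1 => /orP[] /eqP->.
  - by move=> o; rewrite !inE => /orP[] /eqP->.
  - by apply/fsubsetP => a; rewrite !inE -!orbA => /or4P[] /eqP->.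
suff -> : head x w1 = head z v1 by [].
by case: (w1) (v1) def_w def_v => [|a ?] [|b ?] [-> _] [-> _].
Qed.

Lemma left_equiv_of_conditions w v : left_conditions w v -> left_equiv w v.
Proof.
move=> cond phi; pose nonId m := if m is Id then false else true.
pose Y := [fset x in content w | nonId (phi x)]%fset.
have outY s : content s = content w ->
    upper phi (restrict s Y) = upper phi s.
  move=> sw; apply: upper_restrict => x xs.
  have xw : x \in content w by rewrite -sw inE.
  by rewrite inE /= inE xw; case: (phi x).
rewrite -(outY w) // -(outY v) ?cond.1 //.
case: (eqVneq Y fset0) => [->|/eqP Yn0].
  suff res0 s : restrict s fset0 = [::] by rewrite !res0.
  by elim: s => //= a s ->; rewrite inE.
apply: upper_eq_of_left_conditions Yn0 _ cond.
  by move=> a; rewrite !inE => /andP[_]; case: (phi a).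
by apply/fsubsetP => a; rewrite !inE => /andP[].
Qed.

End Sufficiency.

(** * The conditions are necessary *)

Section Necessity.
Variable X : choiceType.
Implicit Types (w v s o : word X) (phi : X -> diagram) (Y : {fset X}).
Implicit Types (C : {fset word X}) (k j : X -> hook).

(** One cup on each row for the letters of [Y], at positions that can be chosen
    independently; the other letters are erased. *)
Definition assign Y k j : X -> diagram :=
  fun u => if u \in Y then Hook (k u) (j u) else Id.

Lemma bend_assign Y k j a b :
  a \in Y -> b \in Y -> bend (assign Y k j) a b = turn (j a) (Cup (k b)).
Proof. by rewrite /bend /exit /assign => -> ->. Qed.

Lemma upper_assign Y k j s :
  upper (assign Y k j) (restrict s Y) = upper (assign Y k j) s.
Proof. by apply: upper_restrict => x _ /negbTE; rewrite /assign => ->. Qed.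

Lemma straight_assign Y k j s : {subset s <= Y} ->
  (forall a b, occurs [:: a; b] s -> turn (j a) (Cup (k b)) = None) ->
  straight (assign Y k j) s.
Proof.
move=> sY bends; apply/straightP; split=> [x /sY|x y occ].
  by rewrite /assign => ->.
by have [/sY xY /sY yY] := occurs_pair_mem occ; rewrite bend_assign ?bends.
Qed.

Lemma upper_straight_assign Y k j s :
  (forall a b, occurs [:: a; b] (restrict s Y) ->
     turn (j a) (Cup (k b)) = None) ->
  upper (assign Y k j) s
  = if first_letter (restrict s Y) is Some p then Cup (k p) else Whole.
Proof.
move=> bends; rewrite -upper_assign.
have sY : {subset restrict s Y <= Y}.
  by move=> a; rewrite in_restrict => /andP[].
have := straight_assign sY bends.
case: (restrict s Y) sY => // p r sY str.
by rewrite (upper_straight str) /entry /assign sY ?mem_head.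
Qed.

Lemma left_equiv_first w v Y : left_equiv w v ->
  first_letter (restrict w Y) = first_letter (restrict v Y).
Proof.
have half_first w' v' : left_equiv w' v' -> forall p,
    first_letter (restrict w' Y) = Some p ->
    first_letter (restrict v' Y) = Some p.
  move=> wv p first_w.
  pose k u := if u == p then h1 else h2; pose j (u : X) := h2.
  have bends s a b : occurs [:: a; b] s -> turn (j a) (Cup (k b)) = None.
    by rewrite /k; case: ifP.
  have := wv (assign Y k j); rewrite !upper_straight_assign; try exact: bends.
  rewrite first_w {1}/k eqxx; case: (first_letter _) => // q [].
  by rewrite /k; case: eqP => // ->.
move=> wv; case fw: (first_letter (restrict w Y)) => [p|].
  by rewrite (half_first _ _ wv _ fw).
case fv: (first_letter (restrict v Y)) => [q|//].
by rewrite -fw (half_first _ _ (left_equiv_sym wv) _ fv).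
Qed.

Lemma left_equiv_content w v : left_equiv w v -> content w = content v.
Proof.
move=> wv; apply/fsetP => x; rewrite !inE.
have memE (s : word X) :
    (x \in s) = isSome (first_letter (restrict s [fset x]%fset)).
  elim: s => //= y s IHs; rewrite in_cons IHs in_fset1.
  by rewrite [y == x]eq_sym; case: eqP.
by rewrite !memE (left_equiv_first _ wv).
Qed.

Lemma left_equiv_pairs w v Y s : left_equiv w v -> size s = 2 ->
  occurs s (restrict w Y) <-> occurs s (restrict v Y).
Proof.
move=> wv; case: s => [|x [|y []]] // _.
have half_pairs w' v' : left_equiv w' v' ->
    occurs [:: x; y] (restrict w' Y) -> occurs [:: x; y] (restrict v' Y).
  move=> wv' occ_w; apply/negPn/negP => occ_v.
  (* The only bending pair is xy. *)
  pose k u := if u == y then h3 else h2; pose j u := if u == x then h1 else h2.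
  have := wv' (assign Y k j); rewrite [RHS]upper_straight_assign; last first.
    move=> a b; rewrite /k /j; case: eqP => [->|_]; case: eqP => [->|_] //.
    by move=> occ; rewrite occ in occ_v.
  have subY a : a \in restrict w' Y -> a \in Y by rewrite in_restrict => /andP[].
  have [/subY xY /subY yY] := occurs_pair_mem occ_w.
  have bxy : bend (assign Y k j) x y = Some Lft.
    by rewrite bend_assign // /k /j !eqxx.
  rewrite -upper_assign; case: (restrict w' Y) occ_w subY => // p r occ_w subY.
  have hook_a a : a \in Y -> is_hook (assign Y k j a) by rewrite /assign => ->.
  have str_p : straight (assign Y k j) (rcons [::] p).
    by rewrite /straight /= hook_a ?subY ?mem_head.
  have nonId a : a \in r -> assign Y k j a <> Id.
    move=> ar hId; have := hook_a a.
    by rewrite hId subY ?inE ?ar ?orbT // => /(_ isT).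
  have [|[w1 [a [b [w2 [e [def_w strw bab]]]]]]] := straight_or_bend str_p nonId.
    by case/straightP => _ /(_ _ _ occ_w); rewrite bxy.
  rewrite -[p :: r]/([::] ++ p :: r) def_w.
  by rewrite (upper_bend _ strw bab); case: first_letter.
by split; apply: half_pairs => //; apply: left_equiv_sym.
Qed.

Lemma bends_agree phi Y w v w1 w2 v1 v2 x y z t e e' : left_equiv w v ->
  (forall a, a \notin Y -> phi a = Id) ->
  restrict w Y = w1 ++ [:: x; y] ++ w2 -> restrict v Y = v1 ++ [:: z; t] ++ v2 ->
  straight phi (w1 ++ [:: x]) -> straight phi (v1 ++ [:: z]) ->
  bend phi x y = Some e -> bend phi z t = Some e' -> e = e'.
Proof.
move=> wv outY def_w def_v; rewrite !cats1 => strw strv bw bv.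
have := wv phi; have := left_equiv_first Y wv.
rewrite -(@upper_restrict _ _ w Y) -?(@upper_restrict _ _ v Y);
  try by move=> a _ /outY.
rewrite def_w def_v (upper_bend _ strw bw) (upper_bend _ strv bv) => first_wv.
have -> : head x w1 = head z v1.
  by case: (w1) (v1) first_wv => [|a ?] [|b ?] [->].
by move=> [] /extra_inj.
Qed.

Lemma no_opposite_assignment Y w v w1 w2 v1 v2 x y z t C k j :
  left_equiv w v ->
  restrict w Y = w1 ++ [:: x; y] ++ w2 -> restrict v Y = v1 ++ [:: z; t] ++ v2 ->
  w1 ++ [:: x] \in C -> v1 ++ [:: z] \in C ->
  (forall a b o, o \in C -> {subset o <= Y} -> occurs [:: a; b] o ->
     turn (j a) (Cup (k b)) = None) ->
  turn (j x) (Cup (k y)) = Some Lft -> turn (j z) (Cup (k t)) = Some Rgt ->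
  False.
Proof.
move=> wv def_w def_v wC vC bends bw bv.
have [xY yY _ _ w1xY] := subset_restrict_factor def_w.
have [zY tY _ _ v1zY] := subset_restrict_factor def_v.
suff : Lft = Rgt by [].
apply: (bends_agree (phi := assign Y k j) wv _ def_w def_v).
- by move=> a /negbTE; rewrite /assign => ->.
- by apply: straight_assign => // a b; apply: bends.
- by apply: straight_assign => // a b; apply: bends.
- by rewrite bend_assign.
- by rewrite bend_assign.
Qed.

(** Here row 1 contains both sides: xy is placed at (1,3) and xt at (1,4). *)
Lemma left_equiv_same_source Y w v w1 w2 v1 v2 x y t C :
  left_equiv w v ->
  restrict w Y = w1 ++ [:: x; y] ++ w2 -> restrict v Y = v1 ++ [:: x; t] ++ v2 ->
  w1 ++ [:: x] \in C -> v1 ++ [:: x] \in C -> y <> t ->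
  occurs_in_none [:: x; y] C -> occurs_in_none [:: x; t] C -> False.
Proof.
move=> wv def_w def_v wC vC yt nxy nxt.
pose j u := if u == x then h1 else h3.
pose k u := if u == y then h3 else if u == t then h4 else h2.
have ty : (t == y) = false by apply/eqP => ty; apply: yt.
apply: (@no_opposite_assignment Y w v w1 w2 v1 v2 x y x t C k j) => //.
- move=> a b o oC _; rewrite /j /k; case: eqP => [->|_]; last by do 2?case: ifP.
  case: eqP => [-> /(occurs_none_absurd nxy oC)//|_].
  by case: eqP => [-> /(occurs_none_absurd nxt oC)|].
- by rewrite /j /k !eqxx.
- by rewrite /j /k !eqxx ty.
Qed.

(** A letter with two cups can be pulled to both sides, whereas a letter with
    one cup cannot; it may be used because [y] is absent from the prefixes. *)
Lemma left_equiv_same_target Y w v w1 w2 v1 v2 x y z C :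
  left_equiv w v ->
  restrict w Y = w1 ++ [:: x; y] ++ w2 -> restrict v Y = v1 ++ [:: z; y] ++ v2 ->
  w1 ++ [:: x] \in C -> v1 ++ [:: z] \in C -> x <> z ->
  ~ occurs_in_none [:: y] C.
Proof.
move=> wv def_w def_v wC vC xz ny.
have [xY yY _ _ w1xY] := subset_restrict_factor def_w.
have [zY _ _ _ v1zY] := subset_restrict_factor def_v.
(* The half c12_45 turns right below a cup at 1 and left below a cup at 3. *)
pose j u := if u == x then h1 else h3.
pose phi u := if u == y then Flat c12_45 c12_45 else assign Y (fun=> h2) j u.
have notin_y o : o \in C -> y \notin o.
  move=> oC; apply/negP => yo; apply: (occurs_none_absurd ny oC).
  by case/splitPr: yo => o1 o2; apply: infix_infix.
have phiE o : o \in C -> {in o, phi =1 assign Y (fun=> h2) j}.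
  by move=> oC a ao; rewrite /phi; case: eqP ao (notin_y o oC) => // -> ->.
have str o : o \in C -> {subset o <= Y} -> straight phi o.
  move=> oC oY; apply/straightP; split=> [a ao|a b occ].
    by rewrite (phiE o) // /assign oY.
  have [ao bo] := occurs_pair_mem occ.
  rewrite /bend /exit !(phiE o) // /assign !oY //= /j.
  by case: ifP.
have exitE o a : o \in C -> a \in o -> {subset o <= Y} -> exit phi a = j a.
  by move=> oC ao oY; rewrite /exit (phiE o) // /assign oY.
suff : Rgt = Lft by [].
apply: (bends_agree (phi := phi) wv _ def_w def_v).
- move=> a aY; rewrite /phi /assign (negbTE aY); case: eqP aY => // ->.
  by rewrite yY.
- exact: str.
- exact: str.
- rewrite /bend (exitE _ _ wC) //; last by rewrite mem_cat inE eqxx orbT.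
  by rewrite /phi /j !eqxx.
- rewrite /bend (exitE _ _ vC) //; last by rewrite mem_cat inE eqxx orbT.
  by rewrite /phi /j !eqxx; case: eqP => // zx; case: xz.
Qed.

(** If xt were absent, xy, xt and zt could be placed at (1,3), (1,4) and
    (2,4), and no other pair would bend. *)
Lemma left_equiv_crossing Y w v w1 w2 v1 v2 x y z t C :
  left_equiv w v ->
  restrict w Y = w1 ++ [:: x; y] ++ w2 -> restrict v Y = v1 ++ [:: z; t] ++ v2 ->
  w1 ++ [:: x] \in C -> v1 ++ [:: z] \in C -> x <> z -> y <> t ->
  occurs_in_none [:: x; y] C -> occurs_in_none [:: z; t] C ->
  occurs_in_some [:: x; t] C.
Proof.
move=> wv def_w def_v wC vC xz yt nxy nzt; apply: contrapT => some_xt.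
have nxt : occurs_in_none [:: x; t] C.
  by move=> o oC; apply/negP => occ; apply: some_xt; exists o.
pose j u := if u == x then h1 else if u == z then h2 else h3.
pose k u := if u == y then h3 else if u == t then h4 else h2.
have ty : (t == y) = false by apply/eqP => ty; apply: yt.
have zx : (z == x) = false by apply/eqP => zx; apply: xz.
apply: (@no_opposite_assignment Y w v w1 w2 v1 v2 x y z t C k j) => //.
- move=> a b o oC _; rewrite /j /k; case: eqP => [->|_].
    case: eqP => [-> /(occurs_none_absurd nxy oC)//|_].
    by case: eqP => [-> /(occurs_none_absurd nxt oC)|].
  case: eqP => [->|_]; last by do 2?case: ifP.
  case: eqP => [//|_].
  by case: eqP => [-> /(occurs_none_absurd nzt oC)|].
- by rewrite /j /k !eqxx.
- by rewrite /j /k !eqxx ty zx.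
Qed.

Section Splittings.
Variables (w v w1 w2 v1 v2 : word X) (x y z t : X).
Variables (Y : {fset X}) (C : {fset word X}).
Hypotheses (wv : left_equiv w v)
  (def_w : restrict w Y = w1 ++ [:: x; y] ++ w2)
  (def_v : restrict v Y = v1 ++ [:: z; t] ++ v2)
  (wC : w1 ++ [:: x] \in C) (vC : v1 ++ [:: z] \in C)
  (xz : x <> z) (yt : y <> t).

(** Erasing the letters outside [Y'] keeps the factors xy and zt in place. *)
Lemma no_opposite_assignment_sub Y' k j :
  ([fset x; y; z; t] `<=` Y')%fset -> (Y' `<=` Y)%fset ->
  (forall a b o, o \in C -> a \in Y' -> b \in Y' ->
     occurs [:: a; b] (restrict o Y') -> turn (j a) (Cup (k b)) = None) ->
  turn (j x) (Cup (k y)) = Some Lft -> turn (j z) (Cup (k t)) = Some Rgt ->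
  False.
Proof.
move=> /fsubsetP xyztY' Y'Y bends.
have [xY yY zY tY] : [/\ x \in Y', y \in Y', z \in Y' & t \in Y'].
  by split; apply: xyztY'; rewrite !inE eqxx ?orbT.
pose C' := [fset restrict o Y' | o in C]%fset.
apply: (@no_opposite_assignment Y' w v (restrict w1 Y') (restrict w2 Y')
  (restrict v1 Y') (restrict v2 Y') x y z t C') => //.
- by rewrite -(restrict_restrict w Y'Y) def_w !restrict_cat /= xY yY.
- by rewrite -(restrict_restrict v Y'Y) def_v !restrict_cat /= zY tY.
- by apply/imfsetP; exists (w1 ++ [:: x]); rewrite //= restrict_cat /= xY.
- by apply/imfsetP; exists (v1 ++ [:: z]); rewrite //= restrict_cat /= zY.
move=> a b _ /imfsetP[/= o oC ->] sub occ.
by have [/sub aY' /sub bY'] := occurs_pair_mem occ; apply: bends occ.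
Qed.

(** Rows 1 and 4 for [x] and [z], so that xy and zt lie at (1,3) and (4,2); the
    letters of [Y1] and [Y2] get the columns 3 and 2.  The first tests in [k]
    force [y] and [t] to the right columns even if they belong to [Y2] and
    [Y1]; this is allowed because xy and zt are absent as well. *)
Lemma left_equiv_left_splitting : ~ left_splitting Y C x y z t.
Proof.
case=> Y' [Y1 [Y2 [xyztY' [Y'Y [defY' [_ [noY1 [noY2 no_xyzt]]]]]]]].
pose j u := if u == x then h1 else if u == z then h4 else h2.
pose k u := if u == y then h3 else if u == t then h2
            else if u \in Y1 then h3 else h2.
have ty : (t == y) = false by apply/eqP => ty; apply: yt.
have zx : (z == x) = false by apply/eqP => zx; apply: xz.
apply: (no_opposite_assignment_sub (k := k) (j := j) xyztY' Y'Y).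
- move=> a b o oC _ bY' occ; have [/negP nxy /negP nzt] := no_xyzt o oC.
  rewrite /j /k; case: eqP occ => [->|_].
    case: eqP => [-> //|_]; case: eqP => // _.
    by case: ifP => // /noY1 /(_ o oC) /negP.
  case: eqP => [->|_ _]; last by do 3?case: ifP.
  case: eqP => // _; case: eqP => [-> //|_].
  case: ifP => // bY1; have /noY2 /(_ o oC) /negP// : b \in Y2.
  by move: bY'; rewrite defY' in_fsetU bY1.
- by rewrite /j /k !eqxx.
- by rewrite /j /k !eqxx ty zx.
Qed.

(** Dually, columns 1 and 4 for [y] and [t], with xy and zt at (3,1) and
    (2,4). *)
Lemma left_equiv_right_splitting : ~ right_splitting Y C x y z t.
Proof.
case=> Y' [Y1 [Y2 [xyztY' [Y'Y [defY' [_ [noY1 [noY2 no_xyzt]]]]]]]].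
pose k u := if u == y then h1 else if u == t then h4 else h2.
pose j u := if u == x then h3 else if u == z then h2
            else if u \in Y1 then h3 else h2.
have ty : (t == y) = false by apply/eqP => ty; apply: yt.
have zx : (z == x) = false by apply/eqP => zx; apply: xz.
apply: (no_opposite_assignment_sub (k := k) (j := j) xyztY' Y'Y).
- move=> a b o oC aY' _ occ; have [/negP nxy /negP nzt] := no_xyzt o oC.
  rewrite /j /k; case: (b =P y) occ => [->|_].
    case: eqP => [-> //|_]; case: eqP => // _.
    by case: ifP => // /noY1 /(_ o oC) /negP.
  case: (b =P t) => [->|_ _]; last by do 3?case: ifP.
  case: eqP => // _; case: eqP => [-> //|_].
  case: ifP => // aY1; have /noY2 /(_ o oC) /negP// : a \in Y2.
  by move: aY'; rewrite defY' in_fsetU aY1.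
- by rewrite /j /k !eqxx.
- by rewrite /j /k !eqxx ty zx.
Qed.

End Splittings.

Lemma left_conditions_of_equiv w v : left_equiv w v -> left_conditions w v.
Proof.
move=> wv; split; first exact: left_equiv_content.
move=> Y _ _; split; first exact: left_equiv_first.
split=> [s s2|]; first exact: left_equiv_pairs.
move=> x y z t w1 w2 v1 v2 _ _ _ _ xyzt _ _ _ _ def_w def_v.
set C := [fset _; _]%fset.
have wC : w1 ++ [:: x] \in C by rewrite !inE eqxx.
have vC : v1 ++ [:: z] \in C by rewrite !inE eqxx orbT.
split=> [nxy nzt xz|].
  subst z; apply: (left_equiv_same_source wv def_w def_v wC vC) => // yt.
  by rewrite yt in xyzt.
split=> [ny yt|xz yt nxy nzt].
  subst t; apply: (left_equiv_same_target wv def_w def_v wC vC) ny => xz.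
  by rewrite xz in xyzt.
split; first exact: left_equiv_crossing def_w def_v wC vC xz yt nxy nzt.
split.
  (* The roles of (w, x, y) and (v, z, t) are symmetric. *)
  apply: (left_equiv_crossing (left_equiv_sym wv) def_v def_w vC wC _ _ nzt nxy).
    exact/nesym.
  exact/nesym.
by split; [apply: left_equiv_left_splitting def_w def_v wC vC xz yt
          | apply: left_equiv_right_splitting def_w def_v wC vC xz yt].
Qed.

Lemma left_equivP w v : left_equiv w v <-> left_conditions w v.
Proof.
by split; [apply: left_conditions_of_equiv | apply: left_equiv_of_conditions].
Qed.

End Necessity.

(** * Reversal *)

Section Reversal.
Variable X : choiceType.
Implicit Types (s o : word X) (Y : {fset X}) (C : {fset word X}).

Definition mirror C C' := forall o, (rev o \in C') = (o \in C).

Lemma mirror_sym C C' : mirror C C' -> mirror C' C.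
Proof. by move=> m o; rewrite -m revK. Qed.

Lemma mirror_ends w1 v1 (x z : X) :
  mirror [fset x :: rev w1; z :: rev v1]%fset
         [fset w1 ++ [:: x]; v1 ++ [:: z]]%fset.
Proof.
move=> o; rewrite !inE -[w1 in LHS]revK -[v1 in LHS]revK !cats1 -!rev_cons.
by rewrite !(can_eq (@revK X)).
Qed.

Lemma none_mirror C C' s :
  mirror C C' -> occurs_in_none (rev s) C <-> occurs_in_none s C'.
Proof.
move=> m; split=> none o oC.
  by rewrite /occurs -infix_rev; apply: none; rewrite -m revK.
by rewrite /occurs infix_revLR; apply: none; rewrite m.
Qed.

Lemma some_mirror C C' s :
  mirror C C' -> occurs_in_some (rev s) C -> occurs_in_some s C'.
Proof.
move=> m [o oC occ]; exists (rev o); first by rewrite m.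
by rewrite /occurs -infix_revLR.
Qed.

Lemma occurs_restrict_rev s o Y :
  occurs s (restrict (rev o) Y) = occurs (rev s) (restrict o Y).
Proof. by rewrite restrict_rev /occurs infix_revLR. Qed.

Lemma left_splitting_mirror Y C C' x y z t : mirror C C' ->
  left_splitting Y C' y x t z <-> right_splitting Y C x y z t.
Proof.
move=> m.
have swap : ([fset y; x; t; z] = [fset x; y; z; t])%fset.
  by apply/fsetP => a; rewrite !inE; do 4!case: (a == _).
split=> -[Y' [Y1 [Y2 [sub [Y'Y [defY' [dis [no1 [no2 no]]]]]]]]].
  exists Y', Y1, Y2; split; first by rewrite -swap.
  do 3!split=> //; split=> [u uY o oC|].
    by rewrite -[[:: u; y]]/(rev [:: y; u]) -occurs_restrict_rev no1 ?m.
  split=> [u uY o oC|o oC].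
    by rewrite -[[:: u; t]]/(rev [:: t; u]) -occurs_restrict_rev no2 ?m.
  rewrite -(occurs_restrict_rev [:: y; x]) -(occurs_restrict_rev [:: t; z]).
  by apply: no; rewrite m.
exists Y', Y1, Y2; split; first by rewrite swap.
do 3!split=> //; split=> [u uY o oC|].
  have := no1 u uY (rev o); rewrite occurs_restrict_rev; apply.
  by rewrite -m revK.
split=> [u uY o oC|o oC].
  have := no2 u uY (rev o); rewrite occurs_restrict_rev; apply.
  by rewrite -m revK.
by have := no (rev o); rewrite !occurs_restrict_rev; apply; rewrite -m revK.
Qed.

(** Reversal exchanges the crossed factors xt and zy, and left with right
    splittings. *)
Lemma interlocked_mirror Y C C' x y z t :
  mirror C C' -> interlocked Y C x y z t -> interlocked Y C' y x t z.
Proof.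
move=> m il yt xz nyx ntz.
have [||xt [zy [nl nr]]] := il xz yt.
- exact: (none_mirror _ m).2 nyx.
- exact: (none_mirror _ m).2 ntz.
split; first exact: (some_mirror (s := [:: y; z]) m zy).
split; first exact: (some_mirror (s := [:: t; x]) m xt).
split=> [/(left_splitting_mirror _ _ _ _ _ m)//|].
by move/(left_splitting_mirror _ _ _ _ _ (mirror_sym m)).
Qed.

End Reversal.

(** * The identities of the Jones monoid *)

Theorem theorem4p6 (X : countType) (hX : infinite_set [set: X])
    (w v : word X) :
  satisfies (jones 5) w v <->
  content w = content v /\
  forall Y : {fset X}, Y <> fset0 -> (Y `<=` content w)%fset ->
    first_letter (restrict w Y) = first_letter (restrict v Y) /\
    last_letter (restrict w Y) = last_letter (restrict v Y) /\
    (forall s : word X, size s = 2 ->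
       (occurs s (restrict w Y) <-> occurs s (restrict v Y))) /\
    (forall (x y z t : X) (w1 w2 v1 v2 : word X),
       x \in Y -> y \in Y -> z \in Y -> t \in Y ->
       [:: x; y] <> [:: z; t] ->
       {subset w1 <= Y} -> {subset w2 <= Y} ->
       {subset v1 <= Y} -> {subset v2 <= Y} ->
       restrict w Y = w1 ++ [:: x; y] ++ w2 ->
       restrict v Y = v1 ++ [:: z; t] ++ v2 ->
       let C1 : {fset word X} :=
         [fset w1 ++ [:: x]; v1 ++ [:: z]]%fset in
       let C2 : {fset word X} :=
         [fset y :: w2; t :: v2]%fset in
       (occurs_in_none [:: x; y] C1 -> occurs_in_none [:: z; t] C1 ->
        x <> z) /\
       (occurs_in_none [:: y] C1 -> y <> t) /\
       (occurs_in_none [:: x; y] C2 -> occurs_in_none [:: z; t] C2 ->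
        y <> t) /\
       (occurs_in_none [:: x] C2 -> x <> z) /\
       (forall C : {fset word X}, C \in [:: C1; C2] ->
          x <> z -> y <> t ->
          occurs_in_none [:: x; y] C -> occurs_in_none [:: z; t] C ->
          occurs_in_some [:: x; t] C /\
          occurs_in_some [:: z; y] C /\
          ~ left_splitting Y C x y z t /\
          ~ right_splitting Y C x y z t)).
Proof.
rewrite satisfies_left_equiv !left_equivP; split.
- move=> [[wv condL] [_ condR]]; split=> // Y Y0 Yw.
  have [firstL [pairs compL]] := condL Y Y0 Yw.
  have [|firstR [_ compR]] := condR Y Y0; first by rewrite content_rev.
  split=> //; split; first by move: firstR; rewrite !restrict_rev.
  split=> // x y z t w1 w2 v1 v2 xY yY zY tY xyzt w1Y w2Y v1Y v2Y.
  move=> def_w def_v C1 C2.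
  have [condA [condB il1]] :=
    compL _ _ _ _ _ _ _ _ xY yY zY tY xyzt w1Y w2Y v1Y v2Y def_w def_v.
  have [|||||||condC [condD il2]] :=
    compR y x t z (rev w2) (rev w1) (rev v2) (rev v1) yY xY tY zY;
    try exact: subset_rev.
  + by move=> [yt xz]; apply: xyzt; rewrite yt xz.
  + by rewrite restrict_rev def_w !rev_cat -catA.
  + by rewrite restrict_rev def_v !rev_cat -catA.
  have m : mirror [fset rev w2 ++ [:: y]; rev v2 ++ [:: t]]%fset C2.
    apply: mirror_sym; have := mirror_ends (rev w2) (rev v2) y t.
    by rewrite !revK.
  split=> //; split=> //; split=> [nxy nzt|].
    exact: condC ((none_mirror _ m).2 nxy) ((none_mirror _ m).2 nzt).
  split=> [nx|C].
    exact: condD ((none_mirror _ m).2 nx).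
  rewrite !inE => /orP[] /eqP->; first exact: il1.
  exact: interlocked_mirror m il2.
move=> [wv cond]; split; split=> //.
- move=> Y Y0 Yw; have [firstL [_ [pairs comp]]] := cond Y Y0 Yw.
  split=> //; split=> // x y z t w1 w2 v1 v2 xY yY zY tY xyzt w1Y w2Y v1Y v2Y.
  move=> def_w def_v.
  have [condA [condB [_ [_ il]]]] :=
    comp _ _ _ _ _ _ _ _ xY yY zY tY xyzt w1Y w2Y v1Y v2Y def_w def_v.
  by split=> //; split=> //; apply: il; rewrite inE eqxx.
- by rewrite !content_rev.
move=> Y Y0; rewrite content_rev => Yw.
have [_ [lastL [pairs comp]]] := cond Y Y0 Yw.
rewrite !restrict_rev; split=> //; split=> [s s2|].
  by rewrite /occurs -!infix_revLR; apply: pairs; rewrite size_rev.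
move=> x y z t w1 w2 v1 v2 xY yY zY tY xyzt w1Y w2Y v1Y v2Y def_w def_v.
have [|||||||_ [_ [condC [condD il]]]] :=
  comp y x t z (rev w2) (rev w1) (rev v2) (rev v1) yY xY tY zY;
  try exact: subset_rev.
- by move=> [yt xz]; apply: xyzt; rewrite yt xz.
- by rewrite -[LHS]revK def_w !rev_cat -catA.
- by rewrite -[LHS]revK def_v !rev_cat -catA.
have m := mirror_ends w1 v1 x z.
split=> [nxy nzt|].
  exact: condC ((none_mirror _ m).2 nxy) ((none_mirror _ m).2 nzt).
split=> [ny|].
  exact: condD ((none_mirror _ m).2 ny).
by apply: interlocked_mirror m (il _ _); rewrite !inE eqxx orbT.
Qed.
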